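(* Let $\mathfrak s=\mathbb R b\oplus\tilde{\mathfrak s}$ be the $(n+1)$-dimensional Lie algebra ($n\ge 2$) that extends the abelian Lie algebra $\tilde{\mathfrak s}$ by a symmetric operator $L$ with eigenvalues $\mu_1\le\mu_2\le\dots\le\mu_n$, all different from zero, and let $e_0=b$. If $L$ has both positive and negative eigenvalues and the Weyl connection defined by a left invariant vector field $E\in\mathfrak s$ is non-positive, then either $E=\mu_ne_0$ and all the positive eigenvalues are equal to $\mu_n$, or $E=\mu_1e_0$ and all the negative eigenvalues are equal to $\mu_1$.
   Context: Setting. $\tilde{\mathfrak s}$ is an abelian Lie algebra of dimension $n$, $L:\tilde{\mathfrak s}\to\tilde{\mathfrak s}$ is linear, and $\mathfrak s=\mathbb R b\oplus\tilde{\mathfrak s}$ has bracket $[b,u]=Lu$ and $[u,v]=0$ for $u,v\in\tilde{\mathfrak s}$. $\mathfrak s$ has a scalar product $\langle\cdot,\cdot\rangle$ in which $b$ is a unit vector orthogonal to $\tilde{\mathfrak s}$, and $L$ is symmetric with respect to it. A Lie group $S$ with Lie algebra $\mathfrak s$ carries the corresponding left invariant metric, and elements of $\mathfrak s$ are viewed as left invariant vector fields on $S$. The eigenvalues of $L$ meant are those of $L$ on $\tilde{\mathfrak s}$. Weyl connections. On a Riemannian manifold with metric $\langle\cdot,\cdot\rangle$, Levi-Civita connection $\nabla$ and sectional curvature $K$, for a vector field $E$ let $\varphi=\langle E,\cdot\rangle$. The Weyl connection defined by $E$ is $\widehat\nabla_XY=\nabla_XY+\varphi(Y)X+\varphi(X)Y-\langle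 X,Y\rangle E$. Let $\widehat R(X,Y)=\widehat\nabla_X\widehat\nabla_Y-\widehat\nabla_Y\widehat\nabla_X-\widehat\nabla_{[X,Y]}$ and $\widehat R_a(X,Y)=\widehat R(X,Y)-d\varphi(X,Y)I$ its anti-symmetric part. For a tangent plane $\Pi$ with orthonormal basis $\{X,Y\}$ put $\widehat K(\Pi)=\langle\widehat R_a(X,Y)Y,X\rangle$; equivalently $\widehat K(\Pi)=K(\Pi)-|E_\perp|^2-\langle\nabla_XE,X\rangle-\langle\nabla_YE,Y\rangle$, where $E_\perp$ is the component of $E$ orthogonal to $\Pi$. The Weyl connection is non-positive if $\widehat K(\Pi)\le 0$ for every tangent plane $\Pi$ at every point. *)

(* Defs.v *)
From HB Require Import structures.
From mathcomp Require Import all_boot all_order all_algebra.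
From mathcomp Require Import all_classical all_reals all_analysis.

Set Implicit Arguments.
Unset Strict Implicit.
Unset Printing Implicit Defensive.

Import Order.TTheory GRing.Theory Num.Theory.
Import numFieldNormedType.Exports.

Local Open Scope classical_set_scope.
Local Open Scope ring_scope.

(* On open U, differentiability of all iterated directional derivatives up to
   order k - 1 with continuous k-th ones, that is, the usual class C^k. *)
Fixpoint Ck {R : realType} {V W : normedModType R} (k : nat) (U : set V)
    (f : V -> W) : Prop :=
  match k with
  | 0 => forall x, U x -> {for x, continuous f}
  | k'.+1 => (forall x, U x -> differentiable f x) /\
             forall v : V, Ck k' U (fun x => 'D_v f x)
  end.

Definition smooth_on {R : realType} {V W : normedModType R} (U : set V)
  (f : V -> W) : Prop := forall k, Ck k U f.

(* [unchart] is only meaningful on the image of the domain. *)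
Record chart (R : realType) (m : nat) (S : topologicalType) := Chart {
  dom : set S;
  coord : S -> 'rV[R]_m;
  unchart : 'rV[R]_m -> S }.

Definition img {R : realType} {m : nat} {S : topologicalType}
  (c : chart R m S) : set 'rV[R]_m := coord c @` dom c.

Definition is_chart {R : realType} {m : nat} {S : topologicalType}
    (c : chart R m S) : Prop :=
  [/\ open (dom c), open (img c),
      (forall p, dom c p -> unchart c (coord c p) = p),
      (forall p, dom c p -> {for p, continuous (coord c)}) &
      (forall x, img c x -> {for x, continuous (unchart c)})].

Definition transition {R : realType} {m : nat} {S : topologicalType}
  (c c' : chart R m S) : 'rV[R]_m -> 'rV[R]_m := coord c' \o unchart c.

(* The atlas consists of the charts [chart_at p]; the chart [chart_at p] also
   serves to identify the tangent space at [p] with 'rV[R]_m. *)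
Record lieGroup (R : realType) (m : nat) := LieGroup {
  points :> topologicalType;
  chart_at : points -> chart R m points;
  gmul : points -> points -> points;
  gone : points;
  ginv : points -> points;
  points_hausdorff : hausdorff_space points;
  points_second_countable : @second_countable points;
  chart_atP : forall p, is_chart (chart_at p);
  dom_chart_at : forall p, dom (chart_at p) p;
  smooth_transition : forall p q,
    smooth_on [set x | img (chart_at p) x /\
                       dom (chart_at q) (unchart (chart_at p) x)]
      (transition (chart_at p) (chart_at q));
  gmulA : associative gmul;
  gmul1g : left_id gone gmul;
  gmulVg : left_inverse gone ginv gmul;
  gmul_continuous : continuous (fun pq : points * points => gmul pq.1 pq.2);
  gmul_smooth : forall p q r,
    smooth_on
      [set xy : 'rV[R]_m * 'rV[R]_m |
        [/\ img (chart_at p) xy.1, img (chart_at q) xy.2 &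
            dom (chart_at r) (gmul (unchart (chart_at p) xy.1)
                                   (unchart (chart_at q) xy.2))]]
      (fun xy : 'rV[R]_m * 'rV[R]_m =>
         coord (chart_at r) (gmul (unchart (chart_at p) xy.1)
                                  (unchart (chart_at q) xy.2)));
  ginv_continuous : continuous ginv;
  ginv_smooth : forall p q,
    smooth_on
      [set x | img (chart_at p) x /\
               dom (chart_at q) (ginv (unchart (chart_at p) x))]
      (fun x => coord (chart_at q) (ginv (unchart (chart_at p) x))) }.

(* [X p] is the vector of components of the field X at p in the chart
   [chart_at p]. *)
Definition vfield {R : realType} {m : nat} (S : lieGroup R m) : Type :=
  S -> 'rV[R]_m.

(* The field X in the single chart [chart_at p]: the components of X at each
   nearby point q are transported from the chart [chart_at q]. *)
Definition vf_in_chart {R : realType} {m : nat} {S : lieGroup R m} (p : S)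
    (X : vfield S) : 'rV[R]_m -> 'rV[R]_m :=
  fun y => let q := unchart (chart_at p) y in
    'd (transition (chart_at q) (chart_at p)) (coord (chart_at q) q) (X q).

Definition smooth_vf {R : realType} {m : nat} {S : lieGroup R m}
    (X : vfield S) : Prop :=
  forall p, smooth_on (img (chart_at p)) (vf_in_chart p X).

Definition fun_in_chart {R : realType} {m : nat} {S : lieGroup R m} (p : S)
    (f : S -> R) : 'rV[R]_m -> R^o :=
  fun y => f (unchart (chart_at p) y).

Definition smooth_fun {R : realType} {m : nat} {S : lieGroup R m}
    (f : S -> R) : Prop :=
  forall p, smooth_on (img (chart_at p)) (fun_in_chart p f).

Definition vf_app {R : realType} {m : nat} {S : lieGroup R m}
    (X : vfield S) (f : S -> R) : S -> R :=
  fun p => 'D_(X p) (fun_in_chart p f) (coord (chart_at p) p).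

(* [X, Y]^i = X(Y^i) - Y(X^i), so that [X, Y] f = X (Y f) - Y (X f). *)
Definition vf_bracket {R : realType} {m : nat} {S : lieGroup R m}
    (X Y : vfield S) : vfield S :=
  fun p => 'D_(X p) (vf_in_chart p Y) (coord (chart_at p) p)
         - 'D_(Y p) (vf_in_chart p X) (coord (chart_at p) p).

(* The differential at q of the left translation by h, in the charts at q and
   at h q that define the two tangent spaces. *)
Definition dleft {R : realType} {m : nat} {S : lieGroup R m} (h q : S)
    (x : 'rV[R]_m) : 'rV[R]_m :=
  'd (coord (chart_at (gmul h q)) \o gmul h \o unchart (chart_at q))
     (coord (chart_at q) q) x.

Definition left_invariant {R : realType} {m : nat} {S : lieGroup R m}
    (X : vfield S) : Prop :=
  smooth_vf X /\ forall h q, dleft h q (X q) = X (gmul h q).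

Definition scalar_product {R : realType} {V : lmodType R}
    (ip : V -> V -> R) : Prop :=
  [/\ (forall (a : R) u v w, ip (a *: u + v) w = a * ip u w + ip v w),
      (forall u v, ip u v = ip v u) &
      (forall u, u != 0 -> 0 < ip u u)].

Definition metric_field {R : realType} {m : nat} (S : lieGroup R m) : Type :=
  S -> 'rV[R]_m -> 'rV[R]_m -> R.

Definition vf_inner {R : realType} {m : nat} {S : lieGroup R m}
    (g : metric_field S) (X Y : vfield S) : S -> R :=
  fun p => g p (X p) (Y p).

Definition riemannian_metric {R : realType} {m : nat} {S : lieGroup R m}
    (g : metric_field S) : Prop :=
  (forall p, scalar_product (g p)) /\
  (forall X Y, smooth_vf X -> smooth_vf Y -> smooth_fun (vf_inner g X Y)).

Definition left_invariant_metric {R : realType} {m : nat} {S : lieGroup R m}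
    (g : metric_field S) : Prop :=
  riemannian_metric g /\
  forall h q x y, g (gmul h q) (dleft h q x) (dleft h q y) = g q x y.

Definition connection {R : realType} {m : nat} (S : lieGroup R m) : Type :=
  vfield S -> vfield S -> vfield S.

Definition affine_connection {R : realType} {m : nat} {S : lieGroup R m}
    (D : connection S) : Prop :=
  [/\ (forall X Y, smooth_vf X -> smooth_vf Y -> smooth_vf (D X Y)),
      (forall X X' Y, smooth_vf X -> smooth_vf X' -> smooth_vf Y ->
         forall p, D (fun q => X q + X' q) Y p = D X Y p + D X' Y p),
      (forall f X Y, smooth_fun f -> smooth_vf X -> smooth_vf Y ->
         forall p, D (fun q => f q *: X q) Y p = f p *: D X Y p),
      (forall X Y Y', smooth_vf X -> smooth_vf Y -> smooth_vf Y' ->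
         forall p, D X (fun q => Y q + Y' q) p = D X Y p + D X Y' p) &
      (forall f X Y, smooth_fun f -> smooth_vf X -> smooth_vf Y ->
         forall p, D X (fun q => f q *: Y q) p
                   = vf_app X f p *: Y p + f p *: D X Y p)].

Definition levi_civita {R : realType} {m : nat} {S : lieGroup R m}
    (g : metric_field S) (D : connection S) : Prop :=
  [/\ affine_connection D,
      (forall X Y, smooth_vf X -> smooth_vf Y ->
         forall p, D X Y p - D Y X p = vf_bracket X Y p) &
      (forall X Y Z, smooth_vf X -> smooth_vf Y -> smooth_vf Z ->
         forall p, vf_app X (vf_inner g Y Z) p
                   = vf_inner g (D X Y) Z p + vf_inner g Y (D X Z) p)].

Definition weyl_connection {R : realType} {m : nat} {S : lieGroup R m}
    (g : metric_field S) (D : connection S) (E : vfield S) : connection S :=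
  fun X Y p => D X Y p + vf_inner g E Y p *: X p + vf_inner g E X p *: Y p
             - vf_inner g X Y p *: E p.

Definition curvature {R : realType} {m : nat} {S : lieGroup R m}
    (D : connection S) (X Y Z : vfield S) : vfield S :=
  fun p => D X (D Y Z) p - D Y (D X Z) p - D (vf_bracket X Y) Z p.

(* d phi (X, Y) = X (phi Y) - Y (phi X) - phi [X, Y] for phi = <E, .>; the
   convention without the factor 1/2 is the one for which [weyl_curvature_a]
   is antisymmetric. *)
Definition dphi {R : realType} {m : nat} {S : lieGroup R m}
    (g : metric_field S) (E X Y : vfield S) : S -> R :=
  fun p => vf_app X (vf_inner g E Y) p - vf_app Y (vf_inner g E X) p
         - vf_inner g E (vf_bracket X Y) p.

Definition weyl_curvature_a {R : realType} {m : nat} {S : lieGroup R m}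
    (g : metric_field S) (D : connection S) (E X Y Z : vfield S) : vfield S :=
  fun p => curvature (weyl_connection g D E) X Y Z p - dphi g E X Y p *: Z p.

(* The Weyl sectional curvature of the plane spanned by X p and Y p, when
   these are orthonormal. *)
Definition weyl_sectional {R : realType} {m : nat} {S : lieGroup R m}
    (g : metric_field S) (D : connection S) (E X Y : vfield S) (p : S) : R :=
  g p (weyl_curvature_a g D E X Y Y p) (X p).

(* A tangent plane at p is given by an orthonormal basis, and the latter by
   vector fields X, Y extending it; the curvature is tensorial, so the choice
   of extension is immaterial. *)
Definition weyl_nonpositive {R : realType} {m : nat} {S : lieGroup R m}
    (g : metric_field S) (D : connection S) (E : vfield S) : Prop :=
  forall (p : S) (X Y : vfield S), smooth_vf X -> smooth_vf Y ->
    g p (X p) (X p) = 1 -> g p (Y p) (Y p) = 1 -> g p (X p) (Y p) = 0 ->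
    weyl_sectional g D E X Y p <= 0.

(* The pair (a, u) stands for a b + u; L acts on row vectors, u |-> u *m L. *)
Definition extalg (R : realType) (n : nat) : lmodType R :=
  (R^o * 'rV[R]_n)%type.

Definition ext_b {R : realType} {n : nat} : extalg R n := (1, 0).

Definition ext_in {R : realType} {n : nat} (u : 'rV[R]_n) : extalg R n :=
  (0, u).

(* The bilinear alternating bracket with [b, u] = L u and [u, v] = 0. *)
Definition ext_bracket {R : realType} {n : nat} (L : 'M[R]_n)
    (x y : extalg R n) : extalg R n :=
  (0, x.1 *: (y.2 *m L) - y.1 *: (x.2 *m L)).

(* iota identifies the Lie algebra R b (+) R^n with the Lie algebra of left
   invariant vector fields of S. *)
Definition lie_algebra_of {R : realType} {n : nat} {S : lieGroup R n.+1}
    (L : 'M[R]_n) (iota : extalg R n -> vfield S) : Prop :=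
  [/\ (forall (a : R) x y p, iota (a *: x + y) p = a *: iota x p + iota y p),
      injective iota,
      (forall X, left_invariant X <-> exists x, X = iota x) &
      (forall x y, vf_bracket (iota x) (iota y) = iota (ext_bracket L x y))].

(* Main.v *)
Require Import Defs.
From HB Require Import structures.
From mathcomp Require Import all_boot all_order all_algebra.
From mathcomp Require Import all_classical all_reals all_analysis.
From mathcomp Require Import ring lra.

(** The proof has a geometric half and an algebraic half.

    Inner products of left invariant fields are constant, so torsion-freeness
    and metric compatibility determine the Levi-Civita connection on left
    invariant fields by the Koszul argument ([levi_civita_iota]): it is the
    bilinear product [ext_nabla] of the Lie algebra,
      nabla_b = 0,  nabla_u b = - L u,  nabla_u v = <L u, v> b.
    The sign of the Weyl curvature on left invariant planes thus becomes a
    condition on the metric Lie algebra. Write E = e b + w with w orthogonal to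
    b. When u, v is an orthonormal basis of a plane that contains w, the
    curvature of the plane of a b + c u and v is - A a^2 + B a c - C c^2 with
      A = |L v|^2 - e <L v, v> + <w, u>^2,    B = 2 e <w, u> - <L u, w>,
      C = (e - <L u, u>) (e - <L v, v>) - <L u, v>^2,
    so that A >= 0, C >= 0 and B^2 <= 4 A C ([ext_weyl_sectional],
    [mixed_planes_nonpositive]).

    These inequalities force w = 0 ([parallel_to_b]). Indeed C is a determinant
    of the symmetric operator e - L on a plane containing w; if w <> 0, its
    non-negativity on all these planes makes e - L semidefinite unless
    <(e - L) w, w> = 0, and in the latter case L w = e w ([shifted_form_det]).
    If e - L >= 0, testing the inequalities on an eigenvector of L with positive
    eigenvalue gives again L w = e w ([not_nonneg_shift]); the case e - L <= 0
    follows by changing the signs of L and e, using a negative eigenvalue.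
    Finally L w = e w contradicts B^2 <= 4 A C, because then C = 0 and B <> 0 on
    the planes containing w ([not_eigenvector]). This is where the invertibility
    of L enters.

    Once w = 0, the inequalities on eigenvectors read mu_i (mu_i - e) >= 0 and
    (e - mu_1) (e - mu_n) >= 0. The second one puts e outside the open interval
    between mu_1 and mu_n, and the first one puts e below the positive and above
    the negative eigenvalues; this leaves only the two announced cases. *)

Set Implicit Arguments.
Unset Strict Implicit.
Unset Printing Implicit Defensive.

Import Order.TTheory GRing.Theory Num.Theory.
Import numFieldNormedType.Exports.

Local Open Scope classical_set_scope.
Local Open Scope ring_scope.

(** * Scalar products *)

Section ScalarProduct.
Context {R : realType} {V : lmodType R} {ip : V -> V -> R}.
Hypothesis hip : scalar_product ip.

Lemma ipC u v : ip u v = ip v u. Proof. by case: hip. Qed.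

Lemma ipDl u v w : ip (u + v) w = ip u w + ip v w.
Proof. by case: hip => lin _ _; rewrite -[u in LHS]scale1r lin mul1r. Qed.

Lemma ip0l w : ip 0 w = 0.
Proof. by apply: (@addrI _ (ip 0 w)); rewrite -ipDl !addr0. Qed.

Lemma ipZl a u w : ip (a *: u) w = a * ip u w.
Proof. by case: hip => lin _ _; rewrite -[_ *: _]addr0 lin ip0l addr0. Qed.

Lemma ipNl u w : ip (- u) w = - ip u w.
Proof. by rewrite -scaleN1r ipZl mulN1r. Qed.

Lemma ip0r w : ip w 0 = 0. Proof. by rewrite ipC ip0l. Qed.

Lemma ipDr u v w : ip w (u + v) = ip w u + ip w v.
Proof. by rewrite ipC ipDl !(ipC w). Qed.

Lemma ipZr a u w : ip w (a *: u) = a * ip w u.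
Proof. by rewrite ipC ipZl (ipC w). Qed.

Lemma ipNr u w : ip w (- u) = - ip w u.
Proof. by rewrite ipC ipNl (ipC w). Qed.

Definition ipE := (ipDl, ipDr, ipNl, ipNr, ipZl, ipZr, ip0l, ip0r).

Lemma ip_gt0 u : u != 0 -> 0 < ip u u. Proof. by case: hip => _ _; apply. Qed.

Lemma ip_eq0 u : ip u u = 0 -> u = 0.
Proof.
by have [//|/ip_gt0 u_gt0 u0] := eqVneq u 0; rewrite u0 ltxx in u_gt0.
Qed.

Lemma normalize u : u != 0 ->
  exists2 t : R, t != 0 & ip (t *: u) (t *: u) = 1.
Proof.
move=> /ip_gt0 u_gt0; exists (Num.sqrt (ip u u))^-1.
  by rewrite invr_eq0 sqrtr_eq0 -ltNge.
by rewrite ipZl ipZr mulrA -invfM -expr2 sqr_sqrtr ?ltW// mulVf// gt_eqF.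
Qed.

(** Two independent directions leave, after Gram-Schmidt, something
    orthogonal to any given unit vector. *)
Lemma exists_unit_orthogonal y z v : y != 0 -> z != 0 -> ip y z = 0 ->
  ip v v = 1 -> exists2 u, ip u u = 1 & ip u v = 0.
Proof.
move=> y0 z0 yz v1.
suff [r r0 rv] : exists2 r, r != 0 & ip r v = 0.
  have [t _ tr] := normalize r0; exists (t *: r) => //.
  by rewrite ipZl rv mulr0.
have [/eqP|r0] := eqVneq (y - ip y v *: v) 0; last first.
  by exists (y - ip y v *: v) => //; rewrite !ipE v1; ring.
rewrite subr_eq0 => /eqP yE; exists z => //.
have : ip y v * ip z v = 0 by rewrite -ipZr -yE ipC.
move=> /eqP; rewrite mulf_eq0 => /orP[/eqP yv|/eqP//].
by rewrite yE yv scale0r eqxx in y0.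
Qed.

Lemma orthonormal_span y z v w : y != 0 -> z != 0 -> ip y z = 0 ->
  ip v v = 1 -> exists u, [/\ ip u u = 1, ip u v = 0 &
    w = ip w u *: u + ip w v *: v].
Proof.
move=> y0 z0 yz v1; set r := w - ip w v *: v.
have rv : ip r v = 0 by rewrite /r !ipE v1; ring.
have wE : w = r + ip w v *: v by rewrite /r subrK.
clearbody r.
have [r0|r0] := eqVneq r 0.
  have [u u1 uv] := exists_unit_orthogonal y0 z0 yz v1; exists u; split=> //.
  have wu : ip w u = 0 by rewrite wE r0 !ipE (ipC v) uv; ring.
  by rewrite {1}wE r0 wu scale0r.
have [t t0 t1] := normalize r0; exists (t *: r); split=> //.
  by rewrite ipZl rv mulr0.
have wr : ip w r = ip r r by rewrite {1}wE !ipE (ipC v) rv; ring.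
rewrite {1}wE ipZr wr scalerA; congr (_ + _).
move: t1; rewrite ipZl ipZr => t1.
by rewrite [X in X *: r](_ : _ = 1) ?scale1r//; lra.
Qed.

End ScalarProduct.

(** * The Weyl curvature of a product on a vector space *)

Section AlgebraicWeylCurvature.
Context {R : realType} {V : lmodType R} (ip : V -> V -> R).
Hypothesis hip : scalar_product ip.
Context (nab : V -> V -> V).
Hypothesis nab_linear :
  forall x a y z, nab x (a *: y + z) = a *: nab x y + nab x z.
Hypothesis nab_metric : forall x y z, ip (nab x y) z = - ip y (nab x z).

Definition alg_weyl (E x y : V) : V :=
  nab x y + ip E y *: x + ip E x *: y - ip x y *: E.

Definition alg_curvature (D : V -> V -> V) (x y z : V) : V :=
  D x (D y z) - D y (D x z) - D (nab x y - nab y x) z.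

(** The value K - |E_perp|^2 - <nabla_x E, x> - <nabla_y E, y> known on manifolds,
    with the curvature term d phi omitted since it is orthogonal to x. The term
    in nab y E comes from <E, nab y y> = - <nab y E, y>, and the terms in the
    bracket cancel those in nab x y and nab y y. *)
Lemma alg_weyl_sectional E x y :
  ip x x = 1 -> ip y y = 1 -> ip x y = 0 ->
  ip (alg_curvature (alg_weyl E) x y y) x =
  ip (alg_curvature nab x y y) x - (ip E E - ip E x ^+ 2 - ip E y ^+ 2)
  - ip (nab x E) x - ip (nab y E) y.
Proof.
move=> x1 y1 xy.
have nabD u a b : nab u (a + b) = nab u a + nab u b.
  by rewrite -[a in LHS]scale1r nab_linear scale1r.
have nab0 u : nab u 0 = 0.
  by apply: (@addrI _ (nab u 0)); rewrite -nabD !addr0.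
have nabZ u (t : R) a : nab u (t *: a) = t *: nab u a.
  by rewrite -[t *: a]addr0 nab_linear nab0 addr0.
have nabN u a : nab u (- a) = - nab u a by rewrite -scaleN1r nabZ scaleN1r.
have skew0 u a : ip (nab u a) a = 0.
  have := nab_metric u a a; rewrite [ip a _](ipC hip); lra.
have yx : ip y x = 0 by rewrite (ipC hip).
have nyx_y : ip (nab y x) y = - ip (nab y y) x.
  by rewrite nab_metric (ipC hip).
have nyE : ip E (nab y y) = - ip (nab y E) y by rewrite nab_metric opprK.
have nyy : ip y (nab y y) = 0 by rewrite (ipC hip) skew0.
have nxyy : ip y (nab x y) = 0 by rewrite (ipC hip) skew0.
have xE : ip x E = ip E x by rewrite (ipC hip).
have nyyx : ip x (nab y y) = ip (nab y y) x by rewrite (ipC hip).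
rewrite /alg_curvature /alg_weyl !(nabD, nabZ, nabN, ipE hip).
rewrite !(x1, y1, xy, yx, skew0, nyx_y, nyE, nyy, nxyy, xE, nyyx).
ring.
Qed.

End AlgebraicWeylCurvature.

(** * Left invariant metrics and their Levi-Civita connection *)

Section KoszulUniqueness.
Context {R : realType} {V : Type} {W : lmodType R} {G : W -> W -> R}.

(** The Koszul argument: exchanging arguments around the cycle (x, y, z) by the
    two symmetries returns to the start with the opposite sign. *)
Lemma symmetric_skew_eq0 (i : V -> W) (T : V -> V -> W) :
    scalar_product G ->
    (forall x y, T x y = T y x) ->
    (forall x y z, G (T x y) (i z) = - G (i y) (T x z)) ->
  forall x y z, G (T x y) (i z) = 0.
Proof.
move=> hG TC Tskew x y z.
have Gskew a b c : G (T a b) (i c) = - G (T a c) (i b).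
  by rewrite Tskew (ipC hG).
have : G (T x y) (i z) = - G (T x y) (i z).
  rewrite {1}Gskew (TC x z) Gskew opprK (TC z y) Gskew (TC y x); ring.
lra.
Qed.

End KoszulUniqueness.

Section LeftInvariant.
Context {R : realType} {m : nat} {S : lieGroup R m}.
Implicit Types (p q : S) (X Y : vfield S).

(** The group axioms in use are one-sided, hence the next two lemmas. *)
Lemma gmulgV p : gmul p (ginv p) = gone S.
Proof.
rewrite -[LHS]gmul1g -{1}(gmulVg (ginv p)) -gmulA (gmulA _ p) gmulVg.
by rewrite gmul1g gmulVg.
Qed.

Lemma gmulg1 p : gmul p (gone S) = p.
Proof. by rewrite -(gmulVg p) gmulA gmulgV gmul1g. Qed.

(** Left invariant fields are the left translates of their values at the unit,
    and left translations are isometries. *)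
Lemma vf_inner_left_invariant (g : metric_field S) X Y p :
  left_invariant_metric g -> left_invariant X -> left_invariant Y ->
  vf_inner g X Y p = vf_inner g X Y (gone S).
Proof.
move=> [_ gE] [_ XE] [_ YE].
by have := gE p (gone S) (X (gone S)) (Y (gone S)); rewrite XE YE gmulg1.
Qed.

Lemma vf_app_cst X (k : R) p : vf_app X (fun=> k) p = 0.
Proof. exact: derive_cst. Qed.

End LeftInvariant.

Lemma linear_inj_surj (K : fieldType) (U W : vectType K) (f : U -> W) :
    (forall a x y, f (a *: x + y) = a *: f x + f y) ->
    (forall x, f x = 0 -> x = 0) -> dim U = dim W ->
  forall w, exists x, f x = w.
Proof.
move=> f_lin f_inj dimE w.
pose fL : {linear U -> W} := HB.pack f (GRing.isLinear.Build K U W _ f f_lin).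
have kerf : lker (linfun fL) == 0%VS.
  apply/lker0P => x y; rewrite !lfunE /= => fxy.
  apply/eqP; rewrite -subr_eq0; apply/eqP/f_inj.
  by rewrite -scaleN1r addrC f_lin fxy scaleN1r addNr.
have : w \in limg (linfun fL).
  suff -> : limg (linfun fL) = fullv by rewrite memvf.
  apply/eqP; rewrite eqEdim subvf /= limg_dim_eq ?(eqP kerf) ?capv0//.
  by rewrite !dimvf dimE.
by case/memv_imgP => x _ ->; exists x; rewrite lfunE.
Qed.

Section LieAlgebra.
Context {R : realType} {n : nat} {L : 'M[R]_n}.
Context {ip : extalg R n -> extalg R n -> R} {S : lieGroup R n.+1}.
Context {iota : extalg R n -> vfield S} {g : metric_field S}.
Context {nabla : connection S}.
Hypothesis hip : scalar_product ip.
Hypothesis hiota : lie_algebra_of L iota.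
Hypothesis hg : left_invariant_metric g.
Hypothesis hgip : forall x y,
  g (gone S) (iota x (gone S)) (iota y (gone S)) = ip x y.
Hypothesis hnabla : levi_civita g nabla.

Lemma iota_linear a x y p : iota (a *: x + y) p = a *: iota x p + iota y p.
Proof. by case: hiota. Qed.

Lemma iotaD x y p : iota (x + y) p = iota x p + iota y p.
Proof. by rewrite -[x in LHS]scale1r iota_linear scale1r. Qed.

Lemma iota0 p : iota 0 p = 0.
Proof. by apply: (@addrI _ (iota 0 p)); rewrite -iotaD !addr0. Qed.

Lemma iotaZ a x p : iota (a *: x) p = a *: iota x p.
Proof. by rewrite -[_ *: x]addr0 iota_linear iota0 addr0. Qed.

Lemma iotaB x y p : iota (x - y) p = iota x p - iota y p.
Proof. by rewrite iotaD -scaleN1r iotaZ scaleN1r. Qed.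

Lemma iota_left_invariant x : left_invariant (iota x).
Proof. by case: hiota => _ _ h _; apply/h; exists x. Qed.

Lemma iota_smooth x : smooth_vf (iota x).
Proof. by case: (iota_left_invariant x). Qed.

Lemma iota_inner x y p : g p (iota x p) (iota y p) = ip x y.
Proof.
by rewrite -hgip; apply: vf_inner_left_invariant hg _ _;
  exact: iota_left_invariant.
Qed.

Lemma vf_inner_iota x y : vf_inner g (iota x) (iota y) = fun=> ip x y.
Proof. by apply/funext => p; apply: iota_inner. Qed.

(** The values at p of the left invariant fields depend isometrically on the Lie
    algebra, which has the dimension of the tangent space. Hence an identity of
    tangent vectors can be tested against left invariant fields. *)
Lemma iota_surj p (v : 'rV[R]_n.+1) : exists x, iota x p = v.
Proof.
pose f : R^o * 'rV[R]_n -> 'rV[R]_n.+1 := fun x => iota x p.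
have f_lin a x y : f (a *: x + y) = a *: f x + f y by exact: iota_linear.
have f_inj x : f x = 0 -> x = 0.
  move=> fx0; apply: (ip_eq0 hip); rewrite -(iota_inner x x p).
  have -> : iota x p = 0 by exact: fx0.
  by rewrite (ip0l (hg.1.1 p)).
have dimE : dim (R^o * 'rV[R]_n)%type = dim 'rV[R]_n.+1.
  by rewrite /dim /= -[RHS]add1n; congr (_ + _)%N; exact: mul1n.
by have [x <-] := linear_inj_surj f_lin f_inj dimE v; exists x.
Qed.

Context {nab : extalg R n -> extalg R n -> extalg R n}.
Hypothesis nab_metric : forall x y z, ip (nab x y) z = - ip y (nab x z).
Hypothesis nab_torsion : forall x y, nab x y - nab y x = ext_bracket L x y.

Lemma bracket_iota x y : vf_bracket (iota x) (iota y) = iota (nab x y - nab y x).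
Proof. by rewrite nab_torsion; case: hiota. Qed.

(** The difference T of both sides is symmetric by torsion-freeness, and skew in
    the sense of [symmetric_skew_eq0] by metric compatibility, as the derivative
    of a constant inner product vanishes. *)
Lemma levi_civita_iota x y : nabla (iota x) (iota y) = iota (nab x y).
Proof.
apply/funext => p; have [_ torsion metric] := hnabla.
have hgp : scalar_product (g p) := hg.1.1 p.
pose T a b := nabla (iota a) (iota b) p - iota (nab a b) p.
have TC a b : T a b = T b a.
  apply/eqP; rewrite -subr_eq0 /T opprB [iota _ p - _]addrC addrACA.
  rewrite (torsion _ _ (iota_smooth a) (iota_smooth b)) bracket_iota iotaB.
  by rewrite [- _ + iota _ _]addrC -[X in _ + X]opprB subrr.
have Tskew a b c : g p (T a b) (iota c p) = - g p (iota b p) (T a c).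
  rewrite /T !(ipE hgp) !iota_inner nab_metric.
  have := metric _ _ _ (iota_smooth a) (iota_smooth b) (iota_smooth c) p.
  rewrite vf_inner_iota vf_app_cst /vf_inner; lra.
have T0 := symmetric_skew_eq0 hgp TC Tskew.
apply/eqP; rewrite -subr_eq0; apply/eqP/(ip_eq0 hgp).
by have [z Tz] := iota_surj p (T x y); rewrite -{2}/(T x y) -Tz T0.
Qed.

(** The Weyl connection maps left invariant fields to left invariant fields, so
    the curvature can be computed in the Lie algebra; the term d phi (x, y) y is
    orthogonal to x. *)
Lemma weyl_nonpositive_algebraic E x y :
    weyl_nonpositive g nabla (iota E) ->
    ip x x = 1 -> ip y y = 1 -> ip x y = 0 ->
  ip (alg_curvature nab (alg_weyl ip nab E) x y y) x <= 0.
Proof.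
move=> hE x1 y1 xy.
have weylE a b : weyl_connection g nabla (iota E) (iota a) (iota b) =
    iota (alg_weyl ip nab E a b).
  apply/funext => p; rewrite /weyl_connection levi_civita_iota !vf_inner_iota.
  by rewrite /alg_weyl iotaB !iotaD !iotaZ.
have := hE (gone S) _ _ (iota_smooth x) (iota_smooth y).
rewrite !hgip => /(_ x1 y1 xy).
rewrite /weyl_sectional /weyl_curvature_a /curvature bracket_iota !weylE.
rewrite -!iotaB -iotaZ -iotaB hgip.
suff dropE c (k : R) : ip (c - k *: y) x = ip c x by rewrite dropE.
by rewrite !(ipE hip) [ip y x](ipC hip) xy mulr0 oppr0 addr0.
Qed.

End LieAlgebra.

(** * The extension of an abelian algebra by a symmetric operator *)

Section SolvableExtension.
Context {R : realType} {n : nat} (L : 'M[R]_n).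
Context (ip : extalg R n -> extalg R n -> R).
Hypothesis hip : scalar_product ip.
Hypothesis hb : ip ext_b ext_b = 1.
Hypothesis hbu : forall u : 'rV[R]_n, ip ext_b (ext_in u) = 0.
Hypothesis hL : forall u v : 'rV[R]_n,
  ip (ext_in (u *m L)) (ext_in v) = ip (ext_in u) (ext_in (v *m L)).

Definition ip_in (u v : 'rV[R]_n) : R := ip (ext_in u) (ext_in v).

Lemma ip_in_scalar_product : scalar_product ip_in.
Proof.
split=> [a u v w|u v|u u0]; rewrite /ip_in.
- rewrite -(ipZl hip) -(ipDl hip); congr (ip _ _).
  by apply: injective_projections => //=; rewrite scaler0 addr0.
- exact: ipC.
- by apply: (ip_gt0 hip); apply: contraNneq u0 => -[->].
Qed.

Lemma ip_pair (a c : R^o) (u v : 'rV[R]_n) :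
  ip (a, u) (c, v) = a * c + ip_in u v.
Proof.
have pairE (t : R^o) (z : 'rV[R]_n) :
    (t, z) = t *: (ext_b : extalg R n) + ext_in z.
  apply: injective_projections => /=; last by rewrite scaler0 add0r.
  by rewrite addr0 -[LHS]mulr1.
rewrite !pairE !(ipE hip) hb hbu [ip (ext_in u) ext_b](ipC hip) hbu /ip_in; ring.
Qed.

(** The Levi-Civita product: b is parallel along itself, the abelian ideal is
    parallel along b, and L is the second fundamental form of the ideal. *)
Definition ext_nabla (x y : extalg R n) : extalg R n :=
  (ip_in (x.2 *m L) y.2, - y.1 *: (x.2 *m L)).

Lemma ext_nabla_linear x (a : R) y z :
  ext_nabla x (a *: y + z) = a *: ext_nabla x y + ext_nabla x z.
Proof.
apply: injective_projections => /=; first by rewrite !(ipE ip_in_scalar_product).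
by rewrite scalerA -scalerDl mulrN opprD.
Qed.

Lemma ext_nabla_metric x y z : ip (ext_nabla x y) z = - ip y (ext_nabla x z).
Proof.
case: x y z => [a u] [c v] [d w].
rewrite /ext_nabla !ip_pair /= !(ipE ip_in_scalar_product).
by rewrite [ip_in v _](ipC ip_in_scalar_product); ring.
Qed.

Lemma ext_nabla_torsion x y : ext_nabla x y - ext_nabla y x = ext_bracket L x y.
Proof.
case: x y => [a u] [c v]; apply: injective_projections => /=.
  by rewrite /ip_in hL (ipC hip) subrr.
by rewrite !scaleNr opprK addrC.
Qed.

(** The last line is the squared norm of the part of w outside the span of u and
    v; it vanishes on the planes used below. *)
Lemma ext_weyl_sectional (e : R^o) (w u v : 'rV[R]_n) (a c : R) :
    ip_in u u = 1 -> ip_in v v = 1 -> ip_in u v = 0 -> a ^+ 2 + c ^+ 2 = 1 ->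
  let x : extalg R n := (a : R^o, c *: u) in
  let y : extalg R n := (0 : R^o, v) in
  ip (alg_curvature ext_nabla (alg_weyl ip ext_nabla (e, w)) x y y) x =
  a * c * (2 * e * ip_in w u - ip_in (u *m L) w)
  - a ^+ 2 * (ip_in (v *m L) (v *m L) - e * ip_in (v *m L) v + ip_in w u ^+ 2)
  - c ^+ 2 * ((e - ip_in (u *m L) u) * (e - ip_in (v *m L) v)
              - ip_in (u *m L) v ^+ 2)
  - (ip_in w w - ip_in w u ^+ 2 - ip_in w v ^+ 2).
Proof.
move=> u1 v1 uv ac x y.
have hh := ip_in_scalar_product.
have hLh s t : ip_in s (t *m L) = ip_in (s *m L) t by rewrite /ip_in hL.
rewrite (alg_weyl_sectional hip ext_nabla_linear ext_nabla_metric).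
- rewrite /alg_curvature /ext_nabla /x /y /=.
  rewrite !(ipE hip) !ip_pair /=.
  rewrite !(ipE hh, mulmxDl, mulNmx, mul0mx, oppr0) -?scalemxAl.
  rewrite !(ipE hh) ?u1 ?v1 ?uv.
  (* These are the terms that have to be made homogeneous in (a, c). *)
  have : (a ^+ 2 + c ^+ 2 - 1) *
      (e * ip_in (v *m L) v - e ^+ 2 - ip_in w u ^+ 2) = 0.
    by rewrite ac subrr mul0r.
  rewrite -(hLh (v *m L) v) [ip_in (v *m L) u](ipC hh) hLh; lra.
- by rewrite /x ip_pair !(ipE hh) u1; move: ac; lra.
- by rewrite /y ip_pair v1 mul0r add0r.
- by rewrite /x /y ip_pair !(ipE hh) uv; ring.
Qed.

End SolvableExtension.

(** * Planes containing the component of E in the abelian ideal *)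

Lemma quadratic_form_disc (R : realType) (A B C : R) :
    (forall a c, a ^+ 2 + c ^+ 2 = 1 -> B * (a * c) <= A * a ^+ 2 + C * c ^+ 2) ->
  [/\ 0 <= A, 0 <= C & B ^+ 2 <= 4 * A * C].
Proof.
move=> unitP.
have formP a c : B * (a * c) <= A * a ^+ 2 + C * c ^+ 2.
  have [ac0|ac_neq0] := eqVneq (a ^+ 2 + c ^+ 2) 0.
    move/eqP: ac0; rewrite paddr_eq0 ?sqr_ge0// !sqrf_eq0.
    by move=> /andP[/eqP-> /eqP->]; rewrite expr0n /= !mulr0 addr0.
  have ac_gt0 : 0 < a ^+ 2 + c ^+ 2 by rewrite lt_def ac_neq0 addr_ge0 ?sqr_ge0.
  pose r := (Num.sqrt (a ^+ 2 + c ^+ 2))^-1.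
  have r2 : r ^+ 2 * (a ^+ 2 + c ^+ 2) = 1.
    by rewrite exprVn sqr_sqrtr ?mulVf// ltW.
  have r2_gt0 : 0 < r ^+ 2 by rewrite exprn_gt0// invr_gt0 sqrtr_gt0.
  have := unitP (r * a) (r * c).
  rewrite !exprMn -mulrDr r2 => /(_ erefl) ineq.
  rewrite -(ler_pM2l r2_gt0); lra.
have A_ge0 : 0 <= A by have := formP 1 0; lra.
have C_ge0 : 0 <= C by have := formP 0 1; lra.
split=> //; have [A0|A_neq0] := eqVneq A 0.
  (* The form is then linear in a, and must not depend on a at all. *)
  have := formP (C + 1) B; rewrite A0; nra.
have A_gt0 : 0 < A by rewrite lt_def A_neq0.
(* For a fixed c, the two sides are closest at a = B c / (2 A). *)
by rewrite -(ler_pM2l A_gt0); have := formP B (2 * A); lra.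
Qed.

(** Here h is the scalar product of the abelian ideal and e b + w is the field
    defining the Weyl connection. The form - A a^2 + B a c - C c^2 is the Weyl
    curvature of the plane of v and a b + c u in [ext_weyl_sectional]. *)
Definition mixed_planes_nonpositive {R : realType} {n : nat}
    (h : 'rV[R]_n -> 'rV[R]_n -> R) (L : 'M[R]_n) (e : R) (w : 'rV[R]_n) : Prop :=
  forall u v, h u u = 1 -> h v v = 1 -> h u v = 0 -> w = h w u *: u + h w v *: v ->
  let A := h (v *m L) (v *m L) - e * h (v *m L) v + h w u ^+ 2 in
  let B := 2 * e * h w u - h (u *m L) w in
  let C := (e - h (u *m L) u) * (e - h (v *m L) v) - h (u *m L) v ^+ 2 in
  [/\ 0 <= A, 0 <= C & B ^+ 2 <= 4 * A * C].

(** Replacing b by - b turns L into - L and e into - e, and a into - a, which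
    only changes the sign of B. *)
Lemma mixed_planes_nonpositiveN (R : realType) (n : nat)
    (h : 'rV[R]_n -> 'rV[R]_n -> R) (L : 'M[R]_n) (e : R) (w : 'rV[R]_n) :
    scalar_product h ->
  mixed_planes_nonpositive h L e w -> mixed_planes_nonpositive h (- L) (- e) w.
Proof.
move=> hh planes u v u1 v1 uv wE; have := planes u v u1 v1 uv wE.
rewrite /= !mulmxN !(ipE hh) => -[A_ge0 C_ge0 disc].
by split; [move: A_ge0|move: C_ge0|move: disc]; congr (is_true (_ <= _)); ring.
Qed.

Section ParallelToB.
Context {R : realType} {n : nat} {h : 'rV[R]_n -> 'rV[R]_n -> R}.
Hypothesis hh : scalar_product h.
Context {w y z : 'rV[R]_n}.
Hypotheses (y_neq0 : y != 0) (z_neq0 : z != 0) (yz : h y z = 0).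

(** If w is an eigenvector for e, the plane of a unit vector v orthogonal to w
    and of w has C = 0 and B = e |w|. *)
Lemma not_eigenvector (L : 'M[R]_n) (e : R) :
    mixed_planes_nonpositive h L e w -> w != 0 -> w *m L = e *: w -> e = 0.
Proof.
move=> planes w_neq0 wL; have [t t0 t1] := normalize hh w_neq0.
have [v v1 vw] := exists_unit_orthogonal hh y_neq0 z_neq0 yz t1.
have hwv : h w v = 0.
  move: vw; rewrite (ipC hh) (ipE hh) => /eqP; rewrite mulf_eq0 (negPf t0).
  by move/eqP.
have tt : t * (t * h w w) = 1 by rewrite -t1 !(ipE hh).
have wE : w = h w (t *: w) *: (t *: w) + h w v *: v.
  rewrite hwv scale0r addr0 scalerA !(ipE hh).
  by rewrite [X in X *: w](_ : _ = 1) ?scale1r// -tt; ring.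
have [] := planes _ _ t1 v1 _ wE; first by rewrite (ipC hh).
rewrite -scalemxAl wL !(ipE hh) hwv => _ _.
set A := (X in 4 * X); set C := (X in _ <= 4 * _ * X).
have -> : C = 0.
  by rewrite /C (_ : t * _ = e) ?subrr; [ring|rewrite -[RHS]mulr1 -tt; ring].
rewrite mulr0 => B0.
have : e * (t * h w w) = 0 by nra.
move/eqP; rewrite !mulf_eq0 (negPf t0) (gt_eqF (ip_gt0 hh w_neq0)) !orbF.
by move/eqP.
Qed.

(** C is the determinant of the quadratic form of e - L on an orthonormal basis
    of a plane containing w, and a determinant keeps its sign when the basis is
    changed to w, x. The inequality makes e - L semidefinite as soon as
    <(e - L) w, w> <> 0. *)
Lemma shifted_form_det (L : 'M[R]_n) (e : R) :
    (forall u v, h (u *m L) v = h u (v *m L)) ->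
    mixed_planes_nonpositive h L e w -> w != 0 ->
  forall x, (e * h w x - h (w *m L) x) ^+ 2 <=
  (e * h w w - h (w *m L) w) * (e * h x x - h (x *m L) x).
Proof.
move=> hL planes w_neq0 x.
have ww := ip_gt0 hh w_neq0.
pose k := h x w / h w w; pose r := x - k *: w.
have xE : x = r + k *: w by rewrite /r subrK.
have rw : h r w = 0.
  by rewrite /r !(ipE hh) /k mulfVK ?subrr// gt_eqF.
clearbody r k; have wr : h w r = 0 by rewrite (ipC hh).
have wLr : h (r *m L) w = h (w *m L) r by rewrite hL (ipC hh).
suff ineq : h (w *m L) r ^+ 2 <=
    (e * h w w - h (w *m L) w) * (e * h r r - h (r *m L) r).
  rewrite xE mulmxDl -scalemxAl !(ipE hh) rw wr wLr; move: ineq.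
  set q := h (w *m L) r; set a := h (w *m L) w; set b := h (r *m L) r.
  set d := h r r; set f := h w w => ineq; lra.
have [->|r_neq0] := eqVneq r 0.
  by rewrite mul0mx !(ipE hh) mulr0 subrr mulr0 expr0n.
have [t t0 t1] := normalize hh w_neq0.
have [s s0 s1] := normalize hh r_neq0.
have ts : h (t *: w) (s *: r) = 0 by rewrite !(ipE hh) wr !mulr0.
have wE : w = h w (t *: w) *: (t *: w) + h w (s *: r) *: (s *: r).
  rewrite !(ipE hh) wr mulr0 scale0r addr0 scalerA.
  by rewrite [X in X *: w](_ : _ = 1) ?scale1r// -t1 !(ipE hh) mulrC.
have [_ + _] := planes _ _ t1 s1 ts wE.
rewrite -!scalemxAl !(ipE hh) in t1 s1 *.
have ts_gt0 : 0 < (t * s) ^+ 2 by rewrite exprn_even_gt0//= mulf_neq0.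
move=> C_ge0; rewrite -(ler_pM2l ts_gt0) -subr_ge0.
move: C_ge0; congr (is_true (0 <= _)).
rewrite -{1}[e]mulr1 -{1}t1 -{2}[e]mulr1 -{1}s1; ring.
Qed.

(** Normalize v and complete it by u to a basis of a plane containing w; put
    l = <L u, u> <= e and p = <w, u>. If m < e, then A >= 0 forces p <> 0, while
    B^2 <= 4 A C is p^2 (l^2 + 4 m (e - l)) + 4 m (e - m)^2 (e - l) <= 0, which is
    impossible. Hence m = e, so that C = 0 and B = p (2 e - l) = 0; then p = 0
    and w is a multiple of v. *)
Lemma not_nonneg_shift (L : 'M[R]_n) (e m : R) (v : 'rV[R]_n) :
    (forall a b, h (a *m L) b = h a (b *m L)) ->
    mixed_planes_nonpositive h L e w ->
    (forall x, 0 <= e * h x x - h (x *m L) x) ->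
    v != 0 -> v *m L = m *: v -> 0 < m -> w *m L = e *: w.
Proof.
move=> hL planes nneg v0 vL m_gt0.
wlog v1 : v v0 vL / h v v = 1.
  have [t t0 t1] := normalize hh v0; move=> /(_ (t *: v)); apply=> //.
    by rewrite scaler_eq0 negb_or t0.
  by rewrite -scalemxAl vL !scalerA mulrC.
have [u [u1 uv wE]] := orthonormal_span hh w y_neq0 z_neq0 yz v1.
have m_le_e : m <= e by have := nneg v; rewrite vL !(ipE hh) v1; lra.
have l_le_e : h (u *m L) u <= e by have := nneg u; rewrite u1; lra.
have uLv : h (u *m L) v = 0 by rewrite hL vL (ipE hh) uv mulr0.
have [] := planes _ _ u1 v1 uv wE.
have -> : h (u *m L) w = h w u * h (u *m L) u.
  by rewrite {1}wE !(ipE hh) uLv mulr0 addr0.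
rewrite vL !(ipE hh) v1 uLv expr0n subr0 !mulr1.
set l := h (u *m L) u in l_le_e *; set p := h w u => A_ge0 C_ge0 disc.
have [e_eq|e_neq] := eqVneq m e.
  have p0 : p = 0.
    move: disc; rewrite e_eq !subrr !mulr0 => sqr_le0.
    have : (p * (2 * e - l)) ^+ 2 == 0.
      by rewrite eq_le sqr_ge0 andbT; move: sqr_le0; lra.
    by rewrite sqrf_eq0 mulf_eq0 [2 * e - l == 0]gt_eqF ?orbF; [move/eqP|lra].
  by rewrite wE -/p p0 scale0r add0r -scalemxAl vL e_eq scalerA mulrC -scalerA.
have m_lt_e : m < e by rewrite lt_neqAle e_neq.
exfalso.
have d_gt0 : 0 < e - m by lra.
have f_ge0 : 0 <= e - l by lra.
have p2_gt0 : 0 < p ^+ 2 by nra.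
have sum_le0 : p ^+ 2 * (l ^+ 2 + 4 * m * (e - l)) +
    4 * m * (e - m) ^+ 2 * (e - l) <= 0 by lra.
have mf_ge0 : 0 <= m * (e - l) by rewrite mulr_ge0// ltW.
have : 0 <= m * (e - l) * (e - m) ^+ 2 by rewrite mulr_ge0// sqr_ge0.
have lmf_gt0 : 0 < l ^+ 2 + 4 * m * (e - l).
  have [l0|l0] := eqVneq l 0; first by rewrite l0; nra.
  have : 0 < l ^+ 2 by rewrite exprn_even_gt0.
  lra.
have := mulr_gt0 p2_gt0 lmf_gt0; lra.
Qed.

(** If w <> 0, the value of the form of e - L at w decides which of the preceding
    lemmas makes w an eigenvector for e: its positive sign is refuted by the
    eigenvector z, its negative sign by y, and its vanishing puts w in the kernel
    of e - L. *)
Lemma parallel_to_b (L : 'M[R]_n) (e lo hi : R) :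
    (forall a b, h (a *m L) b = h a (b *m L)) ->
    (forall x : 'rV[R]_n, x *m L = 0 -> x = 0) ->
    mixed_planes_nonpositive h L e w ->
    y *m L = lo *: y -> lo < 0 -> z *m L = hi *: z -> 0 < hi -> w = 0.
Proof.
move=> hL L_inj planes yL lo_lt0 zL hi_gt0.
have [//|w0] := eqVneq w 0; exfalso.
have not_eig : w *m L <> e *: w.
  move=> wL; have e0 := not_eigenvector planes w0 wL.
  by move/eqP: w0; apply; apply: L_inj; rewrite wL e0 scale0r.
have det x := shifted_form_det hL planes w0 x.
have [q_lt0|q_gt0|q0] := ltgtP (e * h w w - h (w *m L) w) 0.
- apply: not_eig; apply: oppr_inj; rewrite -mulmxN -scaleNr.
  apply: (not_nonneg_shift (v := y) (m := - lo)) => //.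
  + by move=> a b; rewrite !mulmxN !(ipE hh) hL.
  + exact: mixed_planes_nonpositiveN.
  + move=> x; rewrite mulmxN !(ipE hh); have := det x.
    have := sqr_ge0 (e * h w x - h (w *m L) x); nra.
  + by rewrite mulmxN yL scaleNr.
  + by rewrite oppr_gt0.
- apply: not_eig; apply: (not_nonneg_shift (v := z) (m := hi)) => // x.
  have := det x; have := sqr_ge0 (e * h w x - h (w *m L) x); nra.
- apply: not_eig; apply/eqP; rewrite eq_sym -subr_eq0; apply/eqP/(ip_eq0 hh).
  have := det (e *: w - w *m L); rewrite q0 mul0r {1}(ipC hh w).
  move=> det0; apply/eqP; rewrite -sqrf_eq0 eq_le sqr_ge0 andbT.
  move: det0; congr (is_true (_ ^+ 2 <= 0)).
  by rewrite !(ipE hh) [h (w *m L) w](ipC hh); ring.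
Qed.

End ParallelToB.

(** * The defining field is mu_n b or mu_1 b *)

Theorem corollary5p4 (R : realType) (n : nat) (hn : (2 <= n)%N)
    (L : 'M[R]_n) (ip : extalg R n -> extalg R n -> R)
    (hip : scalar_product ip)
    (hb : ip ext_b ext_b = 1)
    (hbu : forall u : 'rV[R]_n, ip ext_b (ext_in u) = 0)
    (hL : forall u v : 'rV[R]_n,
        ip (ext_in (u *m L)) (ext_in v) = ip (ext_in u) (ext_in (v *m L)))
    (mu : nat -> R)
    (hmu : char_poly L = \prod_(1 <= i < n.+1) ('X - (mu i)%:P))
    (hsort : forall i j : nat, (1 <= i)%N -> (i <= j)%N -> (j <= n)%N ->
        mu i <= mu j)
    (hmu0 : forall i : nat, (1 <= i <= n)%N -> mu i != 0)
    (hpos : exists2 i : nat, (1 <= i <= n)%N & 0 < mu i)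
    (hneg : exists2 i : nat, (1 <= i <= n)%N & mu i < 0)
    (S : lieGroup R n.+1) (iota : extalg R n -> vfield S)
    (hiota : lie_algebra_of L iota)
    (g : metric_field S) (hg : left_invariant_metric g)
    (hgip : forall x y : extalg R n,
        g (gone S) (iota x (gone S)) (iota y (gone S)) = ip x y)
    (nabla : connection S) (hnabla : levi_civita g nabla)
    (E : extalg R n) (hE : weyl_nonpositive g nabla (iota E)) :
  (E = mu n *: ext_b /\
     forall i : nat, (1 <= i <= n)%N -> 0 < mu i -> mu i = mu n) \/
  (E = mu 1%N *: ext_b /\
     forall i : nat, (1 <= i <= n)%N -> mu i < 0 -> mu i = mu 1%N).
Proof.
case: E hE => e w hE.
have hh := ip_in_scalar_product hip.
have planes : mixed_planes_nonpositive (ip_in ip) L e w.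
  move=> u v u1 v1 uv wE; apply: quadratic_form_disc => a c ac.
  pose x : extalg R n := (a : R^o, c *: u); pose y : extalg R n := (0 : R^o, v).
  have x1 : ip x x = 1.
    by rewrite (ip_pair hip hb hbu) !(ipE hh) u1; move: ac; lra.
  have y1 : ip y y = 1 by rewrite (ip_pair hip hb hbu) v1 mul0r add0r.
  have xy : ip x y = 0.
    by rewrite (ip_pair hip hb hbu) !(ipE hh) uv !mulr0 addr0.
  have := weyl_nonpositive_algebraic hip hiota hg hgip hnabla
    (ext_nabla_metric L hip hb hbu) (ext_nabla_torsion hip hL) hE x1 y1 xy.
  rewrite (ext_weyl_sectional hip hb hbu hL)//.
  have -> : ip_in ip w w = ip_in ip w u ^+ 2 + ip_in ip w v ^+ 2.
    by rewrite {2}wE !(ipE hh); ring.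
  lra.
have n_gt0 : (0 < n)%N by apply: leq_trans hn.
have mu1_lt0 : mu 1%N < 0.
  by have [i /andP[? ?] /(le_lt_trans _)] := hneg; apply; apply: hsort.
have mun_gt0 : 0 < mu n.
  by have [i /andP[? ?] /lt_le_trans] := hpos; apply; apply: hsort.
have eigenvalueE t : eigenvalue L t = (t \in [seq mu i | i <- index_iota 1 n.+1]).
  rewrite eigenvalue_root_char hmu -root_prod_XsubC.
  by rewrite big_map.
have eigen i : (1 <= i <= n)%N -> exists2 v : 'rV_n, v *m L = mu i *: v & v != 0.
  move=> i_rng; apply/eigenvalueP; rewrite eigenvalueE.
  by rewrite map_f// mem_index_iota ltnS.
have L_inj (x : 'rV_n) : x *m L = 0 -> x = 0.
  move=> xL; apply/eqP/negP => /negP x0.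
  have : eigenvalue L 0 by apply/eigenvalueP; exists x; rewrite ?scale0r.
  rewrite eigenvalueE => /mapP[i]; rewrite mem_index_iota ltnS => i_rng.
  by move/eqP; rewrite eq_sym (negPf (hmu0 _ i_rng)).
have rng1 : (1 <= 1 <= n)%N by rewrite n_gt0.
have rngn : (1 <= n <= n)%N by rewrite n_gt0 leqnn.
have [y yL y0] := eigen _ rng1; have [z zL z0] := eigen _ rngn.
have yz : ip_in ip y z = 0.
  have := hL y z; rewrite -/(ip_in ip _ _) -[RHS]/(ip_in ip _ _) yL zL !(ipE hh).
  move/eqP; rewrite -subr_eq0 -mulrBl mulf_eq0 => /orP[|/eqP//].
  by rewrite subr_eq0 lt_eqF// (lt_trans mu1_lt0).
have w0 : w = 0.
  exact: (parallel_to_b hh y0 z0 yz hL L_inj planes yL mu1_lt0 zL mun_gt0).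
have plane0 u v t : v *m L = t *: v ->
    ip_in ip u u = 1 -> ip_in ip v v = 1 -> ip_in ip u v = 0 ->
    e * t <= t ^+ 2 /\ 0 <= (e - ip_in ip (u *m L) u) * (e - t).
  move=> vL u1 v1 uv.
  have uLv : ip_in ip (u *m L) v = 0.
    by rewrite /ip_in hL vL -/(ip_in ip _ _) (ipE hh) uv mulr0.
  have := planes u v u1 v1 uv; rewrite w0 !(ipE hh) !scale0r addr0 => /(_ erefl).
  by rewrite /= vL uLv !(ipE hh) v1 => -[? ? _]; split; lra.
have mixed i : (1 <= i <= n)%N -> e * mu i <= mu i ^+ 2.
  move=> /eigen[v vL v0]; have [t t0 t1] := normalize hh v0.
  have [u u1 uv] := exists_unit_orthogonal hh y0 z0 yz t1.
  have tvL : (t *: v) *m L = mu i *: (t *: v).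
    by rewrite -scalemxAl vL !scalerA mulrC.
  by case: (plane0 _ _ _ tvL u1 t1 uv).
have extreme : 0 <= (e - mu 1%N) * (e - mu n).
  have [s s0 s1] := normalize hh y0; have [t t0 t1] := normalize hh z0.
  have tzL : (t *: z) *m L = mu n *: (t *: z).
    by rewrite -scalemxAl zL !scalerA mulrC.
  have syL : (s *: y) *m L = mu 1%N *: (s *: y).
    by rewrite -scalemxAl yL !scalerA mulrC.
  have st : ip_in ip (s *: y) (t *: z) = 0 by rewrite !(ipE hh) yz !mulr0.
  have [_] := plane0 _ _ _ tzL s1 t1 st.
  by rewrite syL (ipZl hh) s1 mulr1.
have EE (t : R) : e = t -> (e, w) = t *: (ext_b : extalg R n).
  move=> ->; rewrite w0; apply: injective_projections => /=; last by rewrite scaler0.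
  by rewrite -[LHS]mulr1.
have [e_ge|e_lt] := lerP (mu n) e; [left|right].
  have le_mu i : (1 <= i <= n)%N -> 0 < mu i -> e <= mu i.
    by move=> i_rng mui; have := mixed i i_rng; rewrite expr2 ler_pM2r.
  have eE : e = mu n by apply: le_anti; rewrite e_ge le_mu.
  split=> [|i i_rng mui]; first exact: EE.
  apply: le_anti; rewrite -{2}eE le_mu// andbT.
  by move/andP: i_rng => [? ?]; apply: hsort.
have e_le : e <= mu 1%N by nra.
have ge_mu i : (1 <= i <= n)%N -> mu i < 0 -> mu i <= e.
  by move=> i_rng mui; have := mixed i i_rng; rewrite expr2 ler_nM2r.
have eE : e = mu 1%N by apply: le_anti; rewrite e_le ge_mu.
split=> [|i i_rng mui]; first exact: EE.
apply: le_anti; rewrite -{1}eE ge_mu//.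
by move/andP: i_rng => [? ?]; apply: hsort.
Qed.
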